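(* Let $p\ge3$ be an integer, $\mu\in[0,1)$, and $\xi(t)=\mu t^2+(1-\mu)t^p$. Then the minimizer of $P_{0,\xi}$ on $\mathcal{C}$ is of the form $c+m(1-t)$ with $m,c\in(0,\infty)$ if and only if both (i) the replicon eigenvalue of $\xi$ is non-negative and (ii) $\xi$ is pure-like or critical.
   Context: $\mathcal{C}$ is the set of $\phi\in C([0,1])$ with $\phi\ge0$, non-increasing and concave; $P_{0,\xi}(\phi)=\int_0^1(\xi''\phi+1/\phi)dx$. For $\xi$ as in the claim (which is not of the form $at^2$), the system $$\xi(1)=\frac1m\Big(\frac1m\log\Big(\frac{c+m}{c}\Big)-\frac1{c+m}\Big),\qquad\frac1{\xi'(1)}=c(c+m)$$ has a unique solution with $m,c>0$. For this solution let $\phi(t)=m(1-t)+c$ and let $\eta(t)=\xi(1)-\int_t^1\int_0^s\phi(\tau)^{-2}d\tau\,ds$ (the formal conjugate). The replicon eigenvalue is $\eta''(0)-\xi''(0)$. With $\nu'=\xi'(1)$, $\nu''=\xi''(1)$ (and normalization $\xi(1)=1$), set $ABA=\log(\nu''/\nu')-\frac{(\nu''-\nu')(\nu''-\nu'+\nu'^2)}{\nu''\nu'^2}$; $\xi$ is pure-like if $ABA>0$, critical if $ABA=0$. *)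

(* Defs.v *)
From HB Require Import structures.
From mathcomp Require Import all_boot all_order all_algebra.
From mathcomp Require Import all_classical all_reals all_analysis.
Set Implicit Arguments. Unset Strict Implicit. Unset Printing Implicit Defensive.
Import Order.TTheory GRing.Theory Num.Theory.
Import numFieldNormedType.Exports.
Local Open Scope classical_set_scope.
Local Open Scope ring_scope.

Section Defs.
Variable R : realType.

Definition xi (mu : R) (p : nat) (t : R) : R := mu * t ^+ 2 + (1 - mu) * t ^+ p.

Definition xi1 (mu : R) (p : nat) : R -> R := derive1 (xi mu p).
Definition xi2 (mu : R) (p : nat) : R -> R := derive1 (derive1 (xi mu p)).

Definition in_C (phi : R -> R) : Prop :=
  {within `[0, 1]%classic, continuous phi} /\
  (forall x, x \in `[0, 1] -> 0 <= phi x) /\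
  (forall x y, x \in `[0, 1] -> y \in `[0, 1] -> x <= y -> phi y <= phi x) /\
  (forall x y l, x \in `[0, 1] -> y \in `[0, 1] -> l \in `[0, 1] ->
     (1 - l) * phi x + l * phi y <= phi ((1 - l) * x + l * y)).

Definition inv_ext (a : R) : \bar R := if a == 0 then +oo%E else (a^-1)%:E.

(* P_{0,xi}(phi) = int_0^1 (xi''(x) phi(x) + 1/phi(x)) dx, as an extended
   real-valued Lebesgue integral (the integrand is nonnegative on C). *)
Definition P0 (mu : R) (p : nat) (phi : R -> R) : \bar R :=
  (\int[lebesgue_measure]_(x in `[0%R, 1%R]%classic)
     ((xi2 mu p x * phi x)%:E + inv_ext (phi x)))%E.

Definition oint (a b : R) (f : R -> R) : R :=
  if a <= b then Rintegral lebesgue_measure `[a, b]%classic f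
  else - Rintegral lebesgue_measure `[b, a]%classic f.

Definition mc_system (mu : R) (p : nat) (m c : R) : Prop :=
  xi mu p 1 = m^-1 * (m^-1 * ln ((c + m) / c) - (c + m)^-1) /\
  (xi1 mu p 1)^-1 = c * (c + m).

Definition phi_lin (m c : R) (t : R) : R := m * (1 - t) + c.

Definition eta (mu : R) (p : nat) (m c : R) (t : R) : R :=
  xi mu p 1 - oint t 1 (fun s => oint 0 s (fun tau => (phi_lin m c tau) ^- 2)).

Definition replicon (mu : R) (p : nat) (m c : R) : R :=
  derive1 (derive1 (eta mu p m c)) 0 - xi2 mu p 0.

(* ABA with nu' = xi'(1), nu'' = xi''(1) (xi(1) = 1 automatically) *)
Definition ABA (mu : R) (p : nat) : R :=
  let n1 := xi1 mu p 1 in let n2 := xi2 mu p 1 in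
  ln (n2 / n1) - (n2 - n1) * (n2 - n1 + n1 ^+ 2) / (n2 * n1 ^+ 2).

Definition pure_like_or_critical (mu : R) (p : nat) : Prop :=
  0 < ABA mu p \/ ABA mu p = 0.

End Defs.

(* Main.v *)
(** Write [phi t = m (1 - t) + c] and [f = eta - xi], so that
    [f'' = phi^-2 - xi''].  The functional is convex and the system says that
    [f] and [f'] vanish at [0] and [1], so [f''] is orthogonal to all affine
    functions.

    If the replicon eigenvalue is nonnegative then [{xi'' phi^2 > 1}], where
    [f''] is negative, is an interval.  For [psi] in [C] let [l] be its chord
    over that interval: concavity gives [f'' (psi - l) <= 0] everywhere, so
    [1/psi >= 2/phi - psi/phi^2] integrates to [P0 psi >= P0 phi].

    Conversely, stationarity in [m] and [c] gives the system, and comparing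
    [phi] with its minimum with a line crossing it near [0] or [1] gives
    [f''(0) >= 0] and [f''(1) >= 0].  With [r = (c + m)/c] the system fixes
    [c] and says that [r] is the root above [1] of a function [aba] that is
    first increasing and then decreasing; as [ABA] is the value of [aba] at
    [nu''/nu'], [f''(1) >= 0], i.e. [nu''/nu' <= r], means [ABA >= 0]. *)
Require Import Defs.
From HB Require Import structures.
From mathcomp Require Import all_boot all_order all_algebra.
From mathcomp Require Import all_classical all_reals all_analysis.
From mathcomp Require Import measurable_realfun ring lra.
Import Order.TTheory GRing.Theory Num.Theory.
Import numFieldNormedType.Exports.
Local Open Scope classical_set_scope.
Local Open Scope ring_scope.

(** * Differentiation and integration *)

Section derivation_rules.
Context {R : realType}.
Implicit Types (f g : R -> R) (x : R).

Lemma is_derive_add f g x a b : is_derive x 1 f a -> is_derive x 1 g b ->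
  is_derive x 1 (fun t => f t + g t) (a + b).
Proof. exact: is_deriveD. Qed.

Lemma is_derive_opp f x a : is_derive x 1 f a ->
  is_derive x 1 (fun t => - f t) (- a).
Proof. exact: is_deriveN. Qed.

Lemma is_derive_mul f g x a b : is_derive x 1 f a -> is_derive x 1 g b ->
  is_derive x 1 (fun t => f t * g t) (f x * b + g x * a).
Proof. exact: is_deriveM. Qed.

Lemma is_derive_exp f n x a : is_derive x 1 f a ->
  is_derive x 1 (fun t => f t ^+ n) (n%:R * f x ^+ n.-1 * a).
Proof.
move=> fa; have -> : (fun t => f t ^+ n) = f ^+ n by rewrite exprfctE.
exact: is_deriveX.
Qed.

Lemma is_derive_inv f x a : f x != 0 -> is_derive x 1 f a ->
  is_derive x 1 (fun t => (f t)^-1) (- (f x) ^- 2 * a).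
Proof. exact: is_deriveV. Qed.

Lemma is_derive_ln_comp f x a : 0 < f x -> is_derive x 1 f a ->
  is_derive x 1 (fun t => ln (f t)) ((f x)^-1 * a).
Proof. move=> f0 fa; exact: (is_derive1_comp (is_derive1_ln f0) fa). Qed.

End derivation_rules.

(* Dispatch is syntactic: unification alone would unfold [_ ^+ n] and apply the
   product rule. *)
Ltac derive_step := lazymatch goal with
  | |- is_derive _ _ (fun _ => ?a) _ => exact: is_derive_cst
  | |- is_derive _ _ (fun t => t) _ => exact: is_derive_id
  | |- is_derive _ _ (fun t => (@?f t) + (@?g t)) _ => eapply (@is_derive_add _ f g)
  | |- is_derive _ _ (fun t => - (@?f t)) _ => eapply (@is_derive_opp _ f)
  | |- is_derive _ _ (fun t => (@?f t) * (@?g t)) _ => eapply (@is_derive_mul _ f g)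
  | |- is_derive _ _ (fun t => (@?f t) ^+ ?n) _ => eapply (@is_derive_exp _ f n)
  | |- is_derive _ _ (fun t => (@?f t)^-1) _ => eapply (@is_derive_inv _ f)
  | |- is_derive _ _ (fun t => ln (@?f t)) _ => eapply (@is_derive_ln_comp _ f)
  end.
Ltac derive_eq := eapply is_derive_eq; [repeat derive_step|]; cbv beta.

Section integration.
Context {R : realType}.
Implicit Types (f g : R -> R) (x : R).
Local Notation mu := (@lebesgue_measure R).

Lemma is_derive_continuous f x a : is_derive x 1 f a -> {for x, continuous f}.
Proof. by case=> /derivable1_diffP /differentiable_continuous. Qed.

Lemma integral_FTC (f F : R -> R) (a b : R) : a <= b ->
  (forall x, x \in `[a, b] -> is_derive x 1 F (f x)) ->
  (forall x, x \in `[a, b] -> {for x, continuous f}) ->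
  (\int[mu]_(x in `[a, b]) (f x)%:E = (F b - F a)%:E)%E.
Proof.
rewrite le_eqVlt => /predU1P[-> _ _|ab dF cf].
  by rewrite set_itv1 integral_set1 subrr.
have cF x : x \in `[a, b] -> {for x, continuous F}.
  by move=> /dF /is_derive_continuous.
rewrite (@continuous_FTC2 _ f F)//.
- by apply: continuous_in_subspaceT => x; rewrite inE; exact: cf.
- split.
  + by move=> x /subset_itv_oo_cc /dF [].
  + by apply/cvg_at_right_filter/cF; rewrite bound_itvE ltW.
  + by apply/cvg_at_left_filter/cF; rewrite bound_itvE ltW.
- by move=> x /subset_itv_oo_cc /dF [_ <-]; rewrite derive1E.
Qed.

(** By continuity [g] stays above [g x / 2] on a segment of positive length starting at [x]. *)
Lemma integral_gt0 g (a b x : R) : measurable_fun `[a, b] g ->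
  (forall t, t \in `[a, b] -> 0 <= g t) ->
  x \in `]a, b[ -> {for x, continuous g} -> 0 < g x ->
  (0 < \int[mu]_(t in `[a, b]) (g t)%:E)%E.
Proof.
move=> mg g0 xab cg gx0.
have /nbhs_ballP[e /= e0 He] : \forall t \near x, g x / 2 < g t /\ t \in `[a, b].
  near=> t; split.
    near: t; apply: (cvgr_gt (g x) cg).
    by rewrite ltr_pdivrMr// ltr_pMr// ltr1n.
  by apply: subset_itv_oo_cc; near: t; exact: near_in_itvoo.
pose y := x + e / 2.
have xy : x < y by rewrite ltrDl divr_gt0.
have Ae t : t \in `[x, y] -> ball x e t.
  rewrite in_itv/= => /andP[xt te]; rewrite /ball/= distrC ger0_norm ?subr_ge0//.
  by rewrite ltrBlDl (le_lt_trans te)// ltrD2l ltr_pdivrMr// ltr_pMr// ltr1n.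
have yab : `[x, y]%classic `<=` `[a, b]%classic by move=> t /Ae /He[].
have /measurable_EFinP mA := mg.
apply: (@lt_le_trans _ _ (\int[mu]_(t in `[x, y]) (g t)%:E)%E); last first.
  by apply: ge0_subset_integral => // t /g0; rewrite lee_fin.
apply: (@lt_le_trans _ _ (\int[mu]_(t in `[x, y]) (g x / 2)%:E)%E).
  rewrite integral_cst//= lebesgue_measure_itv/= lte_fin xy.
  by rewrite -EFinB -EFinM lte_fin mulr_gt0 ?divr_gt0 ?subr_gt0.
apply: ge0_le_integral => //.
- by move=> t _; rewrite lee_fin divr_ge0// ltW.
- exact: measurable_funS mA.
- by move=> t /Ae /He[/ltW + _]; rewrite lee_fin.
Unshelve. all: by end_near. Qed.

End integration.

(** * The mixture and affine candidates *)

Section mixture.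
Context {R : realType}.
Implicit Types (mu m c t : R) (p : nat) (psi : R -> R).

Lemma xi1E mu p :
  xi1 mu p = fun t => 2 * mu * t + (1 - mu) * p%:R * t ^+ p.-1.
Proof.
apply/funext => t; rewrite /xi1 derive1E; apply: derive_val.
by rewrite /xi; derive_eq; rewrite /=; ring.
Qed.

Lemma is_derive_xi mu p t : is_derive t 1 (xi mu p) (xi1 mu p t).
Proof. by rewrite xi1E /xi; derive_eq; rewrite /=; ring. Qed.

Lemma xi2E mu p :
  xi2 mu p = fun t => 2 * mu + (1 - mu) * p%:R * p.-1%:R * t ^+ p.-2.
Proof.
apply/funext => t; rewrite /xi2 -/(xi1 mu p) derive1E xi1E; apply: derive_val.
by derive_eq; rewrite /=; ring.
Qed.

Lemma is_derive_xi1 mu p t : is_derive t 1 (xi1 mu p) (xi2 mu p t).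
Proof. by rewrite xi1E xi2E; derive_eq; rewrite /=; ring. Qed.

Lemma continuous_xi2 mu p : continuous (xi2 mu p).
Proof.
move=> t; rewrite xi2E; eapply is_derive_continuous; repeat derive_step.
Qed.

Lemma is_derive_phi_lin m c t : is_derive t 1 (phi_lin m c) (- m).
Proof. by rewrite /phi_lin; derive_eq; ring. Qed.

Lemma continuous_phi_lin m c : continuous (phi_lin m c).
Proof. by move=> t; exact: is_derive_continuous (is_derive_phi_lin m c t). Qed.

End mixture.

Ltac mixture_derive_step := lazymatch goal with
  | |- is_derive _ _ (fun t => xi _ _ t) _ => exact: is_derive_xi
  | |- is_derive _ _ (fun t => xi1 _ _ t) _ => exact: is_derive_xi1
  | |- is_derive _ _ (fun t => phi_lin _ _ t) _ => exact: is_derive_phi_lin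
  | _ => derive_step end.
Ltac mixture_derive_eq :=
  eapply is_derive_eq; [repeat mixture_derive_step|]; cbv beta.

Section affine_candidates.
Context {R : realType}.
Implicit Types (mu m c t : R) (p : nat) (psi : R -> R).
Local Notation leb := (@lebesgue_measure R).

Lemma phi_lin_gt0 m c t : 0 < m -> 0 < c -> t <= 1 -> 0 < phi_lin m c t.
Proof. by move=> m0 c0 t1; rewrite /phi_lin ltr_wpDl// mulr_ge0 ?subr_ge0// ltW. Qed.

Lemma in_C_phi_lin m c : 0 < m -> 0 < c -> in_C (phi_lin m c).
Proof.
move=> m0 c0; split; first exact/continuous_subspaceT/continuous_phi_lin.
split=> [x|].
  by rewrite in_itv/= => /andP[_ /(phi_lin_gt0 _ _ _ m0 c0)/ltW].
split=> [x y _ _ xy|x y l _ _ _]; rewrite /phi_lin; last first.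
  by rewrite le_eqVlt; apply/orP; left; apply/eqP; ring.
by rewrite lerD2r ler_pM2l// lerD2l lerN2.
Qed.

Lemma xi_at1 mu p : xi mu p 1 = 1.
Proof. by rewrite /xi !expr1n !mulr1 addrC subrK. Qed.

Lemma xi_at0 mu p : (1 < p)%N -> xi mu p 0 = 0.
Proof. by case: p => [|[]]// p _; rewrite /xi !expr0n/= !mulr0 addr0. Qed.

Lemma xi1_at0 mu p : (1 < p)%N -> xi1 mu p 0 = 0.
Proof. by case: p => [|[]]// p _; rewrite xi1E !expr0n/= !mulr0 addr0. Qed.

Lemma inv_extE (a : R) : a != 0 -> inv_ext a = (a^-1)%:E.
Proof. by rewrite /inv_ext => /negPf ->. Qed.

Lemma P0_phi_lin mu p m c : (1 < p)%N -> 0 < m -> 0 < c ->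
  P0 mu p (phi_lin m c) = (m + xi1 mu p 1 * c + m^-1 * ln ((c + m) / c))%:E.
Proof.
move=> p1 m0 c0.
(* Integration by parts: as [phi' = - m], the derivative of [xi' phi + m xi] is [xi'' phi]. *)
pose F t := xi1 mu p t * phi_lin m c t + m * xi mu p t -
  m^-1 * ln (phi_lin m c t).
rewrite /P0.
transitivity (\int[leb]_(x in `[0%R, 1%R])
  (xi2 mu p x * phi_lin m c x + (phi_lin m c x)^-1)%:E)%E.
  apply: eq_integral => x; rewrite inE/= in_itv/= => /andP[_ x1].
  by rewrite inv_extE// gt_eqF// phi_lin_gt0.
etransitivity; first apply: (@integral_FTC _ _ F) => //.
- move=> x; rewrite in_itv/= => /andP[_ x1].
  have ? := phi_lin_gt0 m c x m0 c0 x1.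
  rewrite /F; mixture_derive_eq => //; field.
  by rewrite !gt_eqF.
- move=> x; rewrite in_itv/= => /andP[_ x1].
  have ? := phi_lin_gt0 m c x m0 c0 x1.
  apply: continuousD; first apply: continuousM.
  + exact: continuous_xi2.
  + exact: continuous_phi_lin.
  + by apply: continuousV; [rewrite gt_eqF|exact: continuous_phi_lin].
- congr EFin; rewrite /F xi1_at0// xi_at0// xi_at1 ln_div ?posrE ?addr_gt0//.
  by rewrite /phi_lin subrr subr0 !mulr0 mulr1 add0r (addrC c m); ring.
Qed.


Lemma continuous_affine_integrand mu p m c (a b x : R) : 0 < m -> 0 < c ->
  x \in `[0, 1] -> {for x, continuous (fun t => 2 * (phi_lin m c t)^-1 +
     (xi2 mu p t - (phi_lin m c t) ^- 2) * (a + b * t))}.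
Proof.
move=> m0 c0; rewrite in_itv/= => /andP[_ x1].
have ? := phi_lin_gt0 m c x m0 c0 x1.
have cV : {for x, continuous (fun t => (phi_lin m c t)^-1)}.
  by apply: continuousV; [rewrite gt_eqF|exact: continuous_phi_lin].
apply: continuousD; first by apply: continuousM => //; exact: cst_continuous.
apply: continuousM; last first.
  apply: continuousD; first exact: cst_continuous.
  by apply: continuousM; [exact: cst_continuous|].
apply: continuousB; first exact: continuous_xi2.
apply: continuousV; first by rewrite expf_neq0 ?gt_eqF.
by apply: continuousM; exact: continuous_phi_lin.
Qed.

(** The system makes [xi'' - phi^-2] orthogonal to affine functions, so the value does not depend on
    [a] and [b]; when [a + b t] is [phi] itself, the integrand is that of [P0]. *)
Lemma integral_affine mu p m c (a b : R) : (1 < p)%N -> 0 < m -> 0 < c ->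
  mc_system mu p m c ->
  (\int[leb]_(t in `[0%R, 1%R]) (2 * (phi_lin m c t)^-1 +
     (xi2 mu p t - (phi_lin m c t) ^- 2) * (a + b * t))%:E)%E =
  P0 mu p (phi_lin m c).
Proof.
move=> p1 m0 c0 [sys1 sys2].
rewrite P0_phi_lin//.
(* Two integrations by parts. The first and second antiderivatives of [xi'' - phi^-2] are normalized
   to vanish at 0; that they also vanish at 1 is the second and the first equation of the system. *)
pose F t := (xi1 mu p t - m^-1 * ((phi_lin m c t)^-1 - (c + m)^-1)) * (a + b * t)
  - b * (xi mu p t -
         m^-1 * (m^-1 * (ln (c + m) - ln (phi_lin m c t)) - t * (c + m)^-1))
  - 2 * m^-1 * ln (phi_lin m c t).
etransitivity; first apply: (@integral_FTC _ _ F) => //.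
- move=> x; rewrite in_itv/= => /andP[_ x1].
  have ? := phi_lin_gt0 m c x m0 c0 x1.
  rewrite /F; mixture_derive_eq => //; rewrite ?gt_eqF//; field.
  by rewrite !gt_eqF// addr_gt0.
- by move=> x; exact: continuous_affine_integrand.
- congr EFin.
  have {sys2} sys2 : xi1 mu p 1 = (c * (c + m))^-1 by rewrite -sys2 invrK.
  have L : ln ((c + m) / c) = m * (m + (c + m)^-1).
    apply: (@mulfI _ m^-1); first by rewrite invr_eq0 gt_eqF.
    rewrite mulKf ?gt_eqF//; apply/eqP; rewrite -subr_eq; apply/eqP.
    apply: (@mulfI _ m^-1); first by rewrite invr_eq0 gt_eqF.
    by rewrite -sys1 xi_at1 mulVf ?gt_eqF.
  rewrite L; move: L; rewrite ln_div ?posrE ?addr_gt0// => /eqP.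
  rewrite subr_eq => /eqP L.
  rewrite /F xi1_at0// xi_at0// xi_at1 sys2.
  have -> : phi_lin m c 1 = c by rewrite /phi_lin; ring.
  have -> : phi_lin m c 0 = c + m by rewrite /phi_lin; ring.
  by rewrite L; field; rewrite !gt_eqF ?addr_gt0.
Qed.

End affine_candidates.

(** * Comparison on the class C *)

Section minimality.
Context {R : realType}.
Implicit Types (mu m c t : R) (p : nat) (psi : R -> R).
Local Notation leb := (@lebesgue_measure R).

(** Without divisions, the same inequality compares [psi] with a chord inside its interval and with
    the extension of the chord on either side. *)
Lemma in_C_concave3 psi x y z : in_C psi -> 0 <= x -> x < y -> y < z -> z <= 1 ->
  (z - y) * psi x + (y - x) * psi z <= (z - x) * psi y.
Proof.
move=> [_ [_ [_ cc]]] x0 xy yz z1.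
have xz : 0 < z - x by rewrite subr_gt0 (lt_trans xy).
have := cc x z ((y - x) / (z - x)); rewrite !in_itv/=.
have -> : (1 - (y - x) / (z - x)) * x + (y - x) / (z - x) * z = y.
  by field; rewrite gt_eqF.
have -> : (1 - (y - x) / (z - x)) * psi x + (y - x) / (z - x) * psi z =
    ((z - y) * psi x + (y - x) * psi z) / (z - x).
  by field; rewrite gt_eqF.
move=> H; rewrite [leRHS]mulrC -ler_pdivrMr//; apply: H.
- by rewrite x0; lra.
- by rewrite z1; lra.
- apply/andP; split; first by apply: divr_ge0; lra.
  by rewrite ler_pdivrMr// mul1r; lra.
Qed.

(** The set where [s] is positive is an interval, and by the last hypothesis not a single point.
    Take the chord of [psi] over it: a concave function lies above its chord inside and below it
    outside, just as [s] changes sign. *)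
Lemma chord_exists (s : R -> R) psi : in_C psi ->
  (forall x y z, 0 <= x -> x < y -> y < z -> z <= 1 ->
    0 < s x -> 0 < s z -> 0 < s y) ->
  (forall x, 0 <= x <= 1 -> 0 < s x -> exists2 y, 0 <= y <= 1 & y != x /\ 0 < s y) ->
  exists a b, forall t, 0 <= t <= 1 -> 0 <= s t * (psi t - (a + b * t)).
Proof.
move=> Cpsi conv two.
pose S := [set t | 0 <= t <= 1 /\ 0 < s t].
have [S0|/set0P[x0 Sx0]] := eqVneq S set0.
  (* If [s] is nowhere positive, the constant [psi 0] works because [psi] is non-increasing. *)
  exists (psi 0), 0 => t t01.
  rewrite mul0r addr0 mulr_le0//.
    by rewrite leNgt; apply/negP => st; have : S t by []; rewrite S0.
  case: Cpsi => _ [_ [+ _]] => /(_ 0 t); rewrite !in_itv/= lexx ler01 t01 subr_le0.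
  by case/andP: t01 => -> _; exact.
have supS : has_sup S by split; [exists x0|exists 1 => t [/andP[]]].
have infS : has_inf S by split; [exists x0|exists 0 => t [/andP[]]].
set A := inf S; set B := sup S.
have SA t : S t -> A <= t by move=> St; apply: ge_inf => //; case: infS.
have SB t : S t -> t <= B by move=> St; apply: ub_le_sup => //; case: supS.
have A0 : 0 <= A by apply: lb_le_inf; [exists x0|move=> t [/andP[]]].
have B1 : B <= 1 by apply: sup_le_ub; [exists x0|move=> t [/andP[]]].
have AB : A < B.
  have [y y01 [yx sy]] := two _ Sx0.1 Sx0.2.
  have Sy : S y by [].
  have [xy|yx'|e] := ltgtP y x0; last by rewrite e eqxx in yx.
  - by rewrite (le_lt_trans (SA _ Sy))// (lt_le_trans xy)// SB.
  - by rewrite (le_lt_trans (SA _ Sx0))// (lt_le_trans yx')// SB.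
have BA : 0 < B - A by rewrite subr_gt0.
pose b := (psi B - psi A) / (B - A).
exists (psi A - b * A), b => t /andP[t0 t1].
have E : psi t - (psi A - b * A + b * t) =
    ((B - A) * psi t - ((B - t) * psi A + (t - A) * psi B)) / (B - A).
  by rewrite /b; field; rewrite gt_eqF.
rewrite {}E mulrA divr_ge0 ?(ltW BA)//.
(* The infimum [A] and the supremum [B] may lie in [S] or not: there [psi] meets its chord and the
   product is 0 whatever the sign of [s]. *)
have [tA|At|->] := ltgtP t A; last 1 first.
  by rewrite [X in 0 <= _ * X](_ : _ = 0) ?mulr0//; ring.
- rewrite mulr_le0//.
    rewrite leNgt; apply/negP => st; have /SA : S t by split => //; rewrite t0.
    by rewrite leNgt tA.
  have := in_C_concave3 psi t A B Cpsi t0 tA AB B1; lra.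
have [tB|Bt|->] := ltgtP t B; last 1 first.
  by rewrite [X in 0 <= _ * X](_ : _ = 0) ?mulr0//; ring.
- have nS : S !=set0 by exists x0.
  have [x [/andP[x0' _] sx] xt] := inf_lt nS At.
  have [z [/andP[_ z1] sz] tz] := sup_gt nS tB.
  rewrite mulr_ge0 ?(ltW (conv x t z _ _ _ _ _ _))//.
  by have := in_C_concave3 psi A t B Cpsi A0 At tB B1; lra.
- rewrite mulr_le0//.
    rewrite leNgt; apply/negP => st; have /SB : S t by split => //; rewrite t0.
    by rewrite leNgt Bt.
  have := in_C_concave3 psi A B t Cpsi A0 AB Bt t1; lra.
Qed.

(** This admits the competitors of the necessary conditions, which are minima of two lines. *)
Lemma in_C_min phi psi : in_C phi -> in_C psi ->
  in_C (fun t => Num.min (phi t) (psi t)).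
Proof.
move=> [c1 [p1 [d1 k1]]] [c2 [p2 [d2 k2]]]; split; last split; last split.
- by move=> t; apply: continuous_min; [exact: c1|exact: c2].
- by move=> x x01; rewrite le_min p1// p2.
- by move=> x y x01 y01 xy; rewrite le_min !ge_min d1// d2// orbT.
- move=> x y l x01 y01 l01; have := l01; rewrite in_itv/= => /andP[l0 l1].
  rewrite le_min; apply/andP; split.
  + apply: le_trans (k1 x y l x01 y01 l01).
    by apply: lerD; apply: ler_wpM2l; rewrite ?subr_ge0// ge_min lexx.
  + apply: le_trans (k2 x y l x01 y01 l01).
    by apply: lerD; apply: ler_wpM2l; rewrite ?subr_ge0// ge_min lexx orbT.
Qed.

Lemma measurable_inv_ext : measurable_fun setT (@inv_ext R).
Proof.
apply: measurable_fun_if => //.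
- exact: measurable_fun_eqr.
rewrite setTI (_ : _ @^-1` _ = [set x : R | x != 0]); last first.
  by apply/seteqP; split=> x /=; case: (x == 0).
apply/measurable_EFinP; apply: open_continuous_measurable_fun => [|x].
  rewrite (_ : [set x : R | x != 0] = ~` [set 0]).
    exact/closed_openC/closed_eq.
  by apply/seteqP; split=> x /=; [move/eqP|move=> ?; apply/eqP].
rewrite inE/= => x0; exact: inv_continuous.
Qed.

Lemma measurable_P0_integrand mu p psi : in_C psi ->
  measurable_fun (`[0, 1] : set R)
    (fun x => ((xi2 mu p x * psi x)%:E + inv_ext (psi x))%E).
Proof.
move=> [cpsi _].
have mpsi : measurable_fun (`[0, 1] : set R) psi.
  exact: subspace_continuous_measurable_fun.
apply: emeasurable_funD.
  apply/measurable_EFinP/measurable_funM => //.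
  apply: measurable_funTS; apply: continuous_measurable_fun.
  exact: continuous_xi2.
exact: measurableT_comp measurable_inv_ext mpsi.
Qed.

Lemma xi2_ge0 mu p t : 0 <= mu -> mu <= 1 -> 0 <= t -> 0 <= xi2 mu p t.
Proof.
by move=> mu0 mu1 t0; rewrite xi2E addr_ge0 ?mulr_ge0 ?exprn_ge0 ?subr_ge0.
Qed.

Lemma inv_ext_ge0 (a : R) : 0 <= a -> (0 <= inv_ext a)%E.
Proof. by rewrite /inv_ext => a0; case: eqP => // _; rewrite lee_fin invr_ge0. Qed.

(** Convexity of the inverse gives [1/psi >= 2/phi - psi/phi^2]. In the resulting lower bound the
    hypothesis replaces [psi] by [a + b t], and [integral_affine] evaluates the integral. *)
Lemma P0_min_of_affine mu p m c (a b : R) psi : 0 <= mu -> mu <= 1 ->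
  (1 < p)%N -> 0 < m -> 0 < c -> mc_system mu p m c -> in_C psi ->
  (forall t, 0 <= t <= 1 ->
    0 <= (xi2 mu p t - (phi_lin m c t) ^- 2) * (psi t - (a + b * t))) ->
  (P0 mu p (phi_lin m c) <= P0 mu p psi)%E.
Proof.
move=> mu0 mu1 p1 m0 c0 sys Cpsi H.
(* Once the infinite value is excluded, the integrand of [P0 mu p psi] is integrable, as the
   comparison of integrals requires. *)
have [-> |Pfin] := eqVneq (P0 mu p psi) +oo%E; first exact: leey.
have psi0 t : 0 <= t <= 1 -> 0 <= psi t.
  by move=> t01; case: Cpsi => _ [+ _]; apply; rewrite in_itv.
rewrite -(@integral_affine _ mu p m c a b)//; apply: le_integral => //.
- apply: continuous_compact_integrable; first exact: segment_compact.
  apply: continuous_in_subspaceT => x; rewrite inE.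
  exact: continuous_affine_integrand.
- apply/integrableP; split; first exact: measurable_P0_integrand.
  rewrite [ltLHS](_ : _ = P0 mu p psi); first by rewrite ltey.
  apply: eq_integral => t; rewrite inE/= in_itv/= => t01; apply/gee0_abs/adde_ge0.
    by rewrite lee_fin mulr_ge0 ?psi0// xi2_ge0//; case/andP: t01.
  by rewrite inv_ext_ge0// psi0.
- move=> t; rewrite inE/= in_itv/= => t01.
  have [->|psi_neq0] := eqVneq (psi t) 0; first by rewrite /inv_ext eqxx leey.
  have psit : 0 < psi t by rewrite lt_neqAle eq_sym psi_neq0 psi0.
  rewrite inv_extE// lee_fin.
  have phit : 0 < phi_lin m c t by rewrite phi_lin_gt0//; case/andP: t01.
  have := H _ t01; rewrite mulrBr subr_ge0.
  rewrite -(lerD2l (2 * (phi_lin m c t)^-1)).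
  (* This square expands to [1/psi - 2/phi + psi/phi^2]. *)
  have sq : 0 <= psi t * ((psi t)^-1 - (phi_lin m c t)^-1) ^+ 2.
    by rewrite mulr_ge0 ?sqr_ge0// ltW.
  move=> /le_trans; apply; rewrite -subr_ge0; apply: le_trans sq _.
  by rewrite le_eqVlt; apply/orP; left; apply/eqP; field; rewrite !gt_eqF.
Qed.

(** Replacing [phi] by its minimum with the second line [phi'] changes the integrand only where
    [phi' < phi], and there lowers it by [(phi - phi') (xi'' - 1/(phi phi'))], positive by
    hypothesis. By continuity a single such point [x] lowers the integral strictly. *)
Lemma minimizer_le mu p m c m' c' x : 0 <= mu -> mu <= 1 ->
  0 < m -> 0 < c -> 0 < m' -> 0 < c' ->
  (forall psi, in_C psi -> (P0 mu p (phi_lin m c) <= P0 mu p psi)%E) ->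
  (forall t, 0 <= t <= 1 -> phi_lin m' c' t < phi_lin m c t ->
    1 < xi2 mu p t * (phi_lin m c t * phi_lin m' c' t)) ->
  x \in `]0, 1[ -> phi_lin m c x <= phi_lin m' c' x.
Proof.
move=> mu0 mu1 m0 c0 m'0 c'0 Hmin H x01; rewrite leNgt; apply/negP => lt_phi.
set phi := phi_lin m c; set phi' := phi_lin m' c'.
pose psi t := Num.min (phi' t) (phi t).
have Cpsi : in_C psi by apply: in_C_min; exact: in_C_phi_lin.
pose L (f : R -> R) t := xi2 mu p t * f t + (f t)^-1.
have phi0 t : t \in `[0, 1] -> 0 < phi t.
  by rewrite in_itv/= => /andP[_ t1]; exact: phi_lin_gt0.
have psi0 t : t \in `[0, 1] -> 0 < psi t.
  move=> t01; rewrite lt_min phi0// andbT.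
  by move: t01; rewrite in_itv/= => /andP[_ t1]; exact: phi_lin_gt0.
have P0L (f : R -> R) : (forall t, t \in `[0, 1] -> 0 < f t) ->
    P0 mu p f = (\int[leb]_(t in `[0%R, 1%R]) (L f t)%:E)%E.
  move=> f0; apply: eq_integral => t; rewrite inE/= => /f0 ft.
  by rewrite inv_extE// gt_eqF.
have cL (f : R -> R) : continuous f -> (forall t, t \in `[0, 1] -> 0 < f t) ->
    forall t, t \in `[0, 1] -> {for t, continuous (L f)}.
  move=> cf f0 t /f0 ft; apply: continuousD.
    by apply: continuousM; [exact: continuous_xi2|exact: cf].
  by apply: continuousV; [rewrite gt_eqF|exact: cf].
have cphi : continuous phi by exact: continuous_phi_lin.
have cpsi : continuous psi.
  by move=> t; apply: continuous_min; exact: continuous_phi_lin.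
have intL (f : R -> R) : continuous f -> (forall t, t \in `[0, 1] -> 0 < f t) ->
    leb.-integrable `[0, 1] (EFin \o L f).
  move=> cf f0; apply: continuous_compact_integrable; first exact: segment_compact.
  by apply: continuous_in_subspaceT => t; rewrite inE; exact: cL.
have Lneq t : t \in `[0, 1] -> phi' t < phi t -> L psi t < L phi t.
  move=> t01 lt_t; have t01' : 0 <= t <= 1 by move: t01; rewrite in_itv.
  have := H t t01' lt_t; have := psi0 t t01; have := phi0 t t01.
  rewrite /L /psi (min_idPl (ltW lt_t)) => phit psit Q.
  rewrite -subr_gt0 [ltRHS](_ : _ = (phi t - phi' t) *
    ((xi2 mu p t * (phi t * phi' t) - 1) / (phi t * phi' t))); last first.
    by field; rewrite !gt_eqF.
  by rewrite mulr_gt0 ?divr_gt0 ?subr_gt0// mulr_gt0.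
have := Hmin psi Cpsi; rewrite !P0L//; apply/negP; rewrite -ltNge.
rewrite -sube_gt0 -integralB_EFin//; try exact: intL.
have cB t : t \in `[0, 1] -> {for t, continuous (fun t => L phi t - L psi t)}.
  by move=> t01; apply: continuousB; exact: cL.
apply: (@integral_gt0 _ _ _ _ x) => //.
- apply: subspace_continuous_measurable_fun => //.
  by apply: continuous_in_subspaceT => t; rewrite inE; exact: cB.
- move=> t t01; rewrite subr_ge0.
  have [le_t|/(Lneq _ t01)/ltW//] := leP (phi t) (phi' t).
  by rewrite /L /psi (min_idPr le_t).
- by apply: cB; exact: subset_itv_oo_cc x01.
- by rewrite subr_gt0; apply: Lneq => //; exact: subset_itv_oo_cc x01.
Qed.

End minimality.

(** * The system for m and c *)

Section aba.
Context {R : realType}.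
Implicit Types (mu m c t x y z : R) (p : nat).

Lemma MVT_is_derive (f df : R -> R) x y : x < y ->
  (forall z, x <= z <= y -> is_derive z 1 f (df z)) ->
  exists2 z, x < z < y & f y - f x = df z * (y - x).
Proof.
move=> xy dF; have [| |z] := @MVT _ f df x y xy.
- by move=> z /subset_itv_oo_cc; rewrite in_itv/=; exact: dF.
- apply: derivable_within_continuous => z.
  by rewrite in_itv/= => /dF [].
- by rewrite in_itv/= => zxy E; exists z.
Qed.

Definition aba (nu x : R) := ln x - (x - 1) * (x - 1 + nu) / (x * nu).

Lemma is_derive_aba nu x : 0 < nu -> 0 < x ->
  is_derive x 1 (aba nu) ((x - 1) * (nu - 1 - x) / (nu * x ^+ 2)).
Proof.
move=> nu0 x0; rewrite /aba; derive_eq => //; first by rewrite mulf_neq0 ?gt_eqF.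
by field; rewrite !gt_eqF.
Qed.

Lemma aba1 nu : aba nu 1 = 0.
Proof. by rewrite /aba ln1 subrr !mul0r subrr. Qed.

Lemma aba_increasing nu x y : 2 < nu -> 1 <= x -> x < y -> y <= nu - 1 ->
  aba nu x < aba nu y.
Proof.
move=> nu2 x1 xy ynu.
have [|z /andP[xz zy]] := @MVT_is_derive (aba nu)
   (fun x => (x - 1) * (nu - 1 - x) / (nu * x ^+ 2)) x y xy.
  by move=> z /andP[xz _]; apply: is_derive_aba; lra.
rewrite -[aba nu x < _]subr_gt0 => ->.
rewrite mulr_gt0 ?subr_gt0// divr_gt0// mulr_gt0 ?exprn_gt0 ?subr_gt0//; lra.
Qed.

Lemma aba_decreasing nu x y : 2 < nu -> nu - 1 <= x -> x < y ->
  aba nu y < aba nu x.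
Proof.
move=> nu2 nux xy.
have [|z /andP[xz zy]] := @MVT_is_derive (aba nu)
   (fun x => (x - 1) * (nu - 1 - x) / (nu * x ^+ 2)) x y xy.
  by move=> z /andP[xz _]; apply: is_derive_aba; lra.
rewrite -[aba nu y < _]subr_lt0 => ->.
rewrite pmulr_llt0 ?subr_gt0// pmulr_llt0; last first.
  by rewrite invr_gt0 mulr_gt0 ?exprn_gt0//; lra.
by rewrite pmulr_rlt0; lra.
Qed.

(** Starting from 0 at 1, [aba nu] increases up to [nu - 1] and then decreases. A root above 1
    therefore lies beyond [nu - 1], and it is the only sign change there. *)
Lemma aba_ge0 nu r x : 2 < nu -> 1 < r -> aba nu r = 0 -> 1 < x ->
  (0 <= aba nu x) = (x <= r).
Proof.
move=> nu2 r1 r0 x1.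
have pos z : 1 < z -> z <= nu - 1 -> 0 < aba nu z.
  by move=> z1 znu; rewrite -(aba1 nu); exact: aba_increasing.
have rnu : nu - 1 < r.
  by rewrite ltNge; apply/negP => /(pos _ r1); rewrite r0 ltxx.
apply/idP/idP => [|xr]; last first.
  have [/(pos _ x1)/ltW//|nux] := leP x (nu - 1).
  move: xr; rewrite le_eqVlt => /predU1P[->|xr]; first by rewrite r0.
  by rewrite -r0 ltW// aba_decreasing// ltW.
by apply: contraTT; rewrite -!ltNge -r0; apply: aba_decreasing => //; exact: ltW.
Qed.

Lemma aba_root nu : 2 < nu -> exists2 r, 1 < r & aba nu r = 0.
Proof.
move=> nu2; have lo : 0 < aba nu (nu - 1).
  by rewrite -(aba1 nu); apply: aba_increasing; lra.
(* The point is far enough out: the rational term is about [x / nu = 4 nu], while [ln u <= u - 1] at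
   [u = 2 nu] bounds the logarithm by [4 nu - 2]. *)
have hi : aba nu ((2 * nu) ^+ 2) < 0.
  have y0 : 0 < 2 * nu by lra.
  rewrite /aba lnXn// subr_lt0.
  have : ln (2 * nu) <= 2 * nu - 1.
    by rewrite -{1}(subrK 1 (2 * nu)) addrC le_ln1Dx//; lra.
  move=> ln_le; apply: (@le_lt_trans _ _ (2 * (2 * nu - 1))).
    by rewrite -[leLHS]mulr_natl ler_pM2l.
  rewrite ltr_pdivlMr; last by rewrite mulr_gt0 ?exprn_gt0//; lra.
  by nra.
have lt12 : nu - 1 <= (2 * nu) ^+ 2 by nra.
have [||r] := @IVT R (aba nu) (nu - 1) ((2 * nu) ^+ 2) 0 lt12.
- apply: derivable_within_continuous => z; rewrite in_itv/= => /andP[nuz _].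
  by have [] // := is_derive_aba nu z; lra.
- by rewrite ge_min le_max (ltW hi) (ltW lo) orbT.
- by rewrite in_itv/= => /andP[nur _] r0; exists r => //; lra.
Qed.

(** [xi'(1)] is the mean of 2 and [p] with weights [mu] and [1 - mu]. The bound puts the turning
    point [nu - 1] of [aba] to the right of 1. *)
Lemma xi1_at1_gt2 mu p : mu < 1 -> (2 < p)%N -> 2 < xi1 mu p 1.
Proof.
move=> mu1 p2; rewrite xi1E expr1n.
have p3 : 3 <= p%:R :> R by rewrite (ler_nat R 3 p).
by nra.
Qed.

Lemma ABAE mu p : mu < 1 -> (2 < p)%N -> 0 < xi2 mu p 1 ->
  ABA mu p = aba (xi1 mu p 1) (xi2 mu p 1 / xi1 mu p 1).
Proof.
move=> mu1 p2 xi20; have := xi1_at1_gt2 mu p mu1 p2.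
rewrite /ABA /aba => ?; congr (_ - _); field; rewrite !gt_eqF//; lra.
Qed.

(* In the variable [r = (c + m)/c], the second equation reads
   [c^2 xi'(1) r = 1] and turns the first one into [aba (xi'(1)) r = 0]. *)
Lemma mc_systemP mu p m c : 0 < m -> 0 < c -> 0 < xi1 mu p 1 ->
  mc_system mu p m c <->
  aba (xi1 mu p 1) ((c + m) / c) = 0 /\ c ^+ 2 * (xi1 mu p 1 * ((c + m) / c)) = 1.
Proof.
move=> m0 c0; rewrite /mc_system xi_at1 /aba; set nu := xi1 mu p 1 => nu0.
set L := ln _.
have -> : c ^+ 2 * (nu * ((c + m) / c)) = nu * (c * (c + m)).
  by field; rewrite gt_eqF.
have cm0 : 0 < c * (c + m) by rewrite mulr_gt0 ?addr_gt0.
have E2 : (nu^-1 = c * (c + m)) <-> (nu * (c * (c + m)) = 1).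
  split=> [<-|/(congr1 ( *%R nu^-1))]; first by rewrite divff ?gt_eqF.
  by rewrite mulKf ?gt_eqF// mulr1.
have nuE : nu^-1 = c * (c + m) -> nu = (c * (c + m))^-1 by move=> <-; rewrite invrK.
split=> -[H1 /E2 H2]; split=> //.
- have -> : L = m * (m + (c + m)^-1).
    have H1' : 1 * m = L / m - (c + m)^-1.
      by rewrite {1}H1 mulrAC mulVf ?mul1r ?gt_eqF// mulrC.
    apply: (@mulIf _ m^-1); first by rewrite invr_eq0 gt_eqF.
    by rewrite mulrAC mulfV ?gt_eqF// mul1r; lra.
  rewrite nuE; last exact/E2.
  by field; rewrite !gt_eqF ?addr_gt0.
- have -> : L = m * (m + (c + m)^-1).
    move/eqP: H1; rewrite subr_eq0 => /eqP ->.
    rewrite nuE//.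
    by field; rewrite !gt_eqF ?addr_gt0.
  by field; rewrite !gt_eqF ?addr_gt0.
Qed.

Lemma mc_system_exists mu p : 2 < xi1 mu p 1 ->
  exists m c, [/\ 0 < m, 0 < c & mc_system mu p m c].
Proof.
move=> nu2; have [r r1 r0] := aba_root _ nu2.
have nr0 : 0 < xi1 mu p 1 * r by rewrite mulr_gt0//; lra.
(* Solves [c^2 xi'(1) r = 1]; then [m = c (r - 1)] makes the ratio [(c + m)/c] equal to [r]. *)
pose c := (Num.sqrt (xi1 mu p 1 * r))^-1.
have c0 : 0 < c by rewrite invr_gt0 sqrtr_gt0.
have m0 : 0 < c * (r - 1) by rewrite mulr_gt0 ?subr_gt0.
exists (c * (r - 1)), c; split => //; apply/mc_systemP => //; first lra.
have -> : (c + c * (r - 1)) / c = r by field; rewrite gt_eqF.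
by split => //; rewrite exprVn sqr_sqrtr ?ltW// mulVf ?gt_eqF.
Qed.

Lemma mc_system_unique mu p m c m' c' : 2 < xi1 mu p 1 ->
  0 < m -> 0 < c -> 0 < m' -> 0 < c' ->
  mc_system mu p m c -> mc_system mu p m' c' -> m = m' /\ c = c'.
Proof.
move=> nu2 m0 c0 m'0 c'0.
have nu0 : 0 < xi1 mu p 1 by lra.
have gt1 (a b : R) : 0 < a -> 0 < b -> 1 < (b + a) / b.
  by move=> a0 b0; rewrite ltr_pdivlMr// mul1r ltrDl.
move=> /(mc_systemP _ _ _ _ m0 c0 nu0)[r0 cr].
move=> /(mc_systemP _ _ _ _ m'0 c'0 nu0)[r'0 c'r].
(* Each ratio is a root above 1, so [aba_ge0] at the other root bounds it by that root. *)
have rr' : (c + m) / c = (c' + m') / c'.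
  apply/le_anti; rewrite -(aba_ge0 _ _ _ nu2 _ r'0) ?gt1// r0 lexx/=.
  by rewrite -(aba_ge0 _ _ _ nu2 _ r0) ?gt1// r'0 lexx.
have cc' : c = c'.
  have : c ^+ 2 = c' ^+ 2.
    apply: (@mulIf _ (xi1 mu p 1 * ((c + m) / c))); last by rewrite cr rr' c'r.
    by rewrite gt_eqF// mulr_gt0// divr_gt0 ?addr_gt0.
  by move/eqP; rewrite eqrXn2 ?ltW// => /eqP.
split=> //; move: rr'; rewrite cc' => /divIf.
by move=> H; apply: (@addrI _ c'); apply: H; rewrite gt_eqF.
Qed.

End aba.

(** * The replicon eigenvalue *)

Section replicon.
Context {R : realType}.
Implicit Types (mu m c t s : R) (p : nat).

(** Both orders of the endpoints matter: [replicon] differentiates [eta] at 0, so [oint 0 s] is met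
    with negative [s]. *)
Lemma oint_FTC (f F : R -> R) (a b : R) :
  (forall x, Num.min a b <= x <= Num.max a b -> is_derive x 1 F (f x)) ->
  (forall x, Num.min a b <= x <= Num.max a b -> {for x, continuous f}) ->
  oint a b f = F b - F a.
Proof.
move=> dF cf; rewrite /oint /Rintegral; have [ab|/ltW ba] := leP a b.
  suff -> : (\int[lebesgue_measure]_(x in `[a, b]) (f x)%:E = (F b - F a)%:E)%E by [].
  apply: integral_FTC => // x; rewrite in_itv/=.
  - by move: (dF x); rewrite min_l// max_r.
  - by move: (cf x); rewrite min_l// max_r.
suff -> : (\int[lebesgue_measure]_(x in `[b, a]) (f x)%:E = (F a - F b)%:E)%E.
  by rewrite /= opprB.
apply: integral_FTC => // x; rewrite in_itv/=.
- by move: (dF x); rewrite min_r// max_l.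
- by move: (cf x); rewrite min_r// max_l.
Qed.

Lemma eq_oint (f g : R -> R) (a b : R) :
  (forall x, Num.min a b <= x <= Num.max a b -> f x = g x) ->
  oint a b f = oint a b g.
Proof.
move=> fg; rewrite /oint; have [ab|/ltW ba] := leP a b.
  apply: eq_Rintegral => x; rewrite inE/= in_itv/= => xab.
  by apply: fg; rewrite min_l// max_r.
congr (- _); apply: eq_Rintegral => x; rewrite inE/= in_itv/= => xab.
by apply: fg; rewrite min_r// max_l.
Qed.

Lemma oint_phi_lin m c s : 0 < m -> 0 < c -> s <= 1 ->
  oint 0 s (fun t => (phi_lin m c t) ^- 2) =
  m^-1 * ((phi_lin m c s)^-1 - (c + m)^-1).
Proof.
move=> m0 c0 s1.
have pos x : Num.min 0 s <= x <= Num.max 0 s -> 0 < phi_lin m c x.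
  by move=> /andP[_ xs]; apply: phi_lin_gt0 => //; apply: le_trans xs _;
    rewrite ge_max ler01.
pose F t := m^-1 * (phi_lin m c t)^-1.
transitivity (F s - F 0); first apply: oint_FTC.
- move=> x /pos phi0; rewrite /F; mixture_derive_eq; first by rewrite gt_eqF.
  by field; rewrite !gt_eqF.
- move=> x /pos phi0; apply: continuousV; first by rewrite expf_neq0 ?gt_eqF.
  by apply: continuousM; exact: continuous_phi_lin.
- have phi0 : phi_lin m c 0 = c + m by rewrite /phi_lin; ring.
  by rewrite /F phi0 mulrBr.
Qed.

Lemma etaE mu p m c t : 0 < m -> 0 < c -> t <= 1 ->
  Defs.eta mu p m c t = xi mu p 1 -
    m^-1 * (m^-1 * (ln (phi_lin m c t) - ln c) - (c + m)^-1 * (1 - t)).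
Proof.
move=> m0 c0 t1; rewrite /Defs.eta; congr (_ - _).
rewrite (@eq_oint _ (fun s => m^-1 * ((phi_lin m c s)^-1 - (c + m)^-1))); last first.
  by move=> s /andP[_]; rewrite max_r// => s1; exact: oint_phi_lin.
have pos x : Num.min t 1 <= x <= Num.max t 1 -> 0 < phi_lin m c x.
  by move=> /andP[_ xs]; apply: phi_lin_gt0 => //; rewrite (le_trans xs)// max_r.
pose F s := - m^-1 * (m^-1 * ln (phi_lin m c s) + (c + m)^-1 * s).
transitivity (F 1 - F t); first apply: oint_FTC.
- move=> x /pos phi0; rewrite /F; mixture_derive_eq => //.
  by field; rewrite !gt_eqF// addr_gt0.
- move=> x /pos phi0; apply: continuousM; first exact: cst_continuous.
  apply: continuousB; last exact: cst_continuous.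
  by apply: continuousV; [rewrite gt_eqF|exact: continuous_phi_lin].
- have phi1 : phi_lin m c 1 = c by rewrite /phi_lin; ring.
  by rewrite /F phi1; ring.
Qed.

Lemma derive1_eta mu p m c t : 0 < m -> 0 < c -> t < 1 ->
  derive1 (Defs.eta mu p m c) t = m^-1 * ((phi_lin m c t)^-1 - (c + m)^-1).
Proof.
move=> m0 c0 t1; rewrite derive1E.
have phi0 : 0 < phi_lin m c t by rewrite phi_lin_gt0// ltW.
rewrite (@near_eq_derive _ _ _ _ (fun t => xi mu p 1 -
    m^-1 * (m^-1 * (ln (phi_lin m c t) - ln c) - (c + m)^-1 * (1 - t)))).
  apply: derive_val; mixture_derive_eq => //.
  by field; rewrite !gt_eqF// addr_gt0.
near=> s; apply: etaE => //; apply: ltW; near: s; exact: (cvgr_lt t cvg_id).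
Unshelve. all: by end_near. Qed.

Lemma repliconE mu p m c : 0 < m -> 0 < c ->
  replicon mu p m c = (c + m) ^- 2 - xi2 mu p 0.
Proof.
move=> m0 c0; rewrite /replicon; congr (_ - _); rewrite derive1E.
have phi0 : 0 < phi_lin m c 0 by rewrite phi_lin_gt0.
rewrite (@near_eq_derive _ _ _ _
  (fun t => m^-1 * ((phi_lin m c t)^-1 - (c + m)^-1))).
  apply: derive_val; mixture_derive_eq; first by rewrite gt_eqF.
  have -> : phi_lin m c 0 = c + m by rewrite /phi_lin; ring.
  by field; rewrite !gt_eqF// addr_gt0.
near=> s; apply: derive1_eta => //; near: s; exact: (cvgr_lt (0 : R) cvg_id).
Unshelve. all: by end_near. Qed.

End replicon.

(** * The set where f'' is negative *)

Section interval.
Context {R : realType}.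
Implicit Types (mu m c t u x y z : R) (p n : nat).

Lemma bernoulli n u : 0 <= u -> 1 + n%:R * (u - 1) <= u ^+ n.
Proof.
move=> u0; elim: n => [|n IH]; first by rewrite mul0r addr0 expr0.
rewrite exprS -natr1; apply: le_trans (ler_wpM2l u0 IH).
rewrite -subr_ge0 [leRHS](_ : _ = n%:R * (u - 1) ^+ 2); last by ring.
by rewrite mulr_ge0 ?sqr_ge0.
Qed.

(* Divided by [t^n], the condition is positivity of [a - b t - g t^-n], which is
   concave in [t > 0]; Bernoulli provides the tangent line at [y]. *)
Lemma superlevel_convex n (a b g : R) x y z : 0 <= g ->
  0 < x -> x < y -> y < z ->
  g < x ^+ n * (a - b * x) -> g < z ^+ n * (a - b * z) ->
  g < y ^+ n * (a - b * y).
Proof.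
move=> g0 x0 xy yz gx gz; rewrite ltNge; apply/negP => gy.
have y0 : 0 < y by rewrite (lt_trans x0).
have z0 : 0 < z by rewrite (lt_trans y0).
pose G := g / y ^+ n.
have G0 : 0 <= G by rewrite divr_ge0// exprn_ge0// ltW.
have tangent t : 0 < t -> g < t ^+ n * (a - b * t) ->
    0 < a - b * t - G * (1 + n%:R * (1 - t / y)).
  move=> t0 gt; rewrite subr_gt0.
  apply: (@le_lt_trans _ _ (G * (y / t) ^+ n)); last first.
    rewrite /G expr_div_n mulrA divfK ?expf_neq0 ?gt_eqF//.
    by rewrite ltr_pdivrMr ?exprn_gt0// mulrC.
  apply: ler_wpM2l => //; apply: le_trans (bernoulli n (y / t) _); last first.
    by rewrite divr_ge0// ltW.
  (* The tangent line has slope [- n / y] in [t]; this step is [y/t - 1 >= 1 - t/y]. *)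
  rewrite lerD2l ler_wpM2l// -subr_ge0.
  rewrite [leRHS](_ : _ = (y - t) ^+ 2 / (t * y)); last by field; rewrite !gt_eqF.
  by rewrite divr_ge0 ?sqr_ge0// mulr_ge0// ltW.
have gy' : a - b * y - G <= 0.
  by rewrite subr_le0 /G ler_pdivlMr ?exprn_gt0// mulrC.
have := tangent x x0 gx; have := tangent z z0 gz.
(* The bound is affine in [s] and at most 0 at [y], hence cannot be positive on both sides of
   [y]. *)
have E s : a - b * s - G * (1 + n%:R * (1 - s / y)) =
   (a - b * y - G) + (s - y) * (G * n%:R / y - b) by field; rewrite gt_eqF.
rewrite !E; set k := _ - b; set h := _ - G; move: gy'; rewrite -/h => h0 hz hx.
have [k0|k0] := leP 0 k.
  have : (x - y) * k <= 0 by rewrite mulr_le0_ge0// subr_le0 ltW.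
  lra.
have : (z - y) * k <= 0 by rewrite mulr_ge0_le0// ?subr_ge0 ltW.
lra.
Qed.

(** Where [phi] is positive, [f'' < 0] means that this exceeds 1. *)
Definition xiphi mu p m c t : R := xi2 mu p t * (phi_lin m c t) ^+ 2.

(** With the factor [phi] pulled out, the rest has the form [t^n (a - b t) - g] treated by
    [superlevel_convex]. *)
Lemma is_derive_xiphi mu n m c t : is_derive t 1 (xiphi mu n.+3 m c)
  (phi_lin m c t * (t ^+ n *
    ((1 - mu) * n.+3%:R * n.+2%:R * n.+1%:R * (c + m) -
     (1 - mu) * n.+3%:R * n.+2%:R * n.+3%:R * m * t) - 4 * m * mu)).
Proof.
rewrite /xiphi xi2E/=; mixture_derive_eq; rewrite /= exprS.
have -> : phi_lin m c t = c + m - m * t by rewrite /phi_lin; ring.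
by rewrite -!natr1; ring.
Qed.

(* Failure would make the derivative of [xi'' phi^2] successively positive,
   negative and positive. *)
Lemma xiphi_interval mu p m c x y z : 0 <= mu -> (2 < p)%N -> 0 < m -> 0 < c ->
  xiphi mu p m c 0 <= 1 -> 0 <= x -> x < y -> y < z -> z <= 1 ->
  1 < xiphi mu p m c x -> 1 < xiphi mu p m c z -> 1 < xiphi mu p m c y.
Proof.
case: p => [|[|[|n]]]// mu0 _ m0 c0 Q0 x0 xy yz z1 Qx Qz.
rewrite ltNge; apply/negP => Qy.
(* A positive [x] leaves room for a mean value point between 0 and [x], where the derivative is
   positive. *)
have {}x0 : 0 < x.
  by rewrite lt_neqAle x0 andbT; apply/eqP => x0'; move: Qx; rewrite -x0' ltNge Q0.
have phi0 t : t < z -> 0 < phi_lin m c t.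
  by move=> tz; apply: phi_lin_gt0 => //; rewrite ltW// (lt_le_trans tz).
have [t1 /andP[t10 t1x] E1] := MVT_is_derive _ _ _ _ x0
  (fun s _ => is_derive_xiphi mu n m c s).
have [t2 /andP[t2x t2y] E2] := MVT_is_derive _ _ _ _ xy
  (fun s _ => is_derive_xiphi mu n m c s).
have [t3 /andP[t3y t3z] E3] := MVT_is_derive _ _ _ _ yz
  (fun s _ => is_derive_xiphi mu n m c s).
have B1 : 0 < xiphi mu n.+3 m c x - xiphi mu n.+3 m c 0 by lra.
have B2 : xiphi mu n.+3 m c y - xiphi mu n.+3 m c x < 0 by lra.
have B3 : 0 < xiphi mu n.+3 m c z - xiphi mu n.+3 m c y by lra.
move: B1; rewrite E1 pmulr_lgt0 ?subr_gt0// pmulr_rgt0 ?subr_gt0; last first.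
  by apply: phi0; lra.
move: B3; rewrite E3 pmulr_lgt0 ?subr_gt0// pmulr_rgt0 ?subr_gt0; last first.
  by apply: phi0; lra.
move=> B3 B1.
have g0 : 0 <= 4 * m * mu by rewrite !mulr_ge0// ltW.
have t12 := lt_trans t1x t2x; have t23 := lt_trans t2y t3y.
have := @superlevel_convex n _ _ _ t1 t2 t3 g0 t10 t12 t23 B1 B3.
move: B2; rewrite E2 pmulr_llt0 ?subr_gt0// pmulr_rlt0; last by apply: phi0; lra.
by lra.
Qed.

(** Since the value at 0 is at most 1, the value halfway between 1 and [xiphi] at [x] is also
    attained. This makes the chord nondegenerate. *)
Lemma xiphi_two mu p m c x : xiphi mu p m c 0 <= 1 -> 0 <= x <= 1 ->
  1 < xiphi mu p m c x ->
  exists2 y, 0 <= y <= 1 & y != x /\ 1 < xiphi mu p m c y.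
Proof.
move=> Q0 /andP[x0 x1] Qx; set Q := xiphi mu p m c in Q0 Qx *.
have cQ : continuous Q.
  move=> t; apply: continuousM; first exact: continuous_xi2.
  by apply: continuousM; exact: continuous_phi_lin.
have [||y] := @IVT R Q 0 x ((1 + Q x) / 2) x0.
- exact: continuous_subspaceT.
- by rewrite ge_min le_max; apply/andP; split; apply/orP; [left|right]; lra.
rewrite in_itv/= => /andP[y0 yx] Qy; exists y.
  by rewrite y0 (le_trans yx).
by split; [apply/eqP => e; move: Qy; rewrite e|rewrite Qy]; lra.
Qed.

End interval.

(** * Necessary conditions *)

Section optimality.
Context {R : realType}.
Implicit Types (mu m c t x y z : R) (p n : nat).

Lemma derive_at_positive_min (f df : R -> R) x :
  (forall y, 0 < y -> is_derive y 1 f (df y)) -> 0 < x ->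
  (forall y, 0 < y -> f x <= f y) -> df x = 0.
Proof.
move=> fdf x0 fmin; have [_ <-] := fdf x x0.
have [||||_ //] := @derive1_at_min R f 0 (x + 1) x.
- by rewrite addr_ge0// ltW.
- by move=> t; rewrite in_itv/= => /andP[/fdf []].
- by rewrite in_itv/= x0 ltrDl ltr01.
- by move=> t; rewrite in_itv/= => /andP[t0 _]; exact: fmin.
Qed.

Lemma minimizer_mc_system mu p m c : (1 < p)%N -> 0 < m -> 0 < c ->
  (forall psi : R -> R, in_C psi -> (P0 mu p (phi_lin m c) <= P0 mu p psi)%E) ->
  mc_system mu p m c.
Proof.
move=> p1 m0 c0 Hmin; set nu := xi1 mu p 1.
have J m' c' : 0 < m' -> 0 < c' ->
    m + nu * c + m^-1 * (ln (c + m) - ln c) <=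
    m' + nu * c' + m'^-1 * (ln (c' + m') - ln c').
  move=> m'0 c'0; have := Hmin _ (in_C_phi_lin _ _ m'0 c'0).
  by rewrite !P0_phi_lin// lee_fin !ln_div ?posrE ?addr_gt0.
(* The partial derivative in [c] vanishes by the second equation of the system, the one in [m] by
   the first. *)
have dc x : 0 < x -> is_derive x 1 (fun y => m + nu * y + m^-1 * (ln (y + m) - ln y))
    (nu + m^-1 * ((x + m)^-1 - x^-1)).
  by move=> x0; mixture_derive_eq => //; rewrite ?addr_gt0//; ring.
have dm x : 0 < x -> is_derive x 1 (fun y => y + nu * c + y^-1 * (ln (c + y) - ln c))
    (1 - x^-1 * (x^-1 * (ln (c + x) - ln c) - (c + x)^-1)).
  move=> x0; mixture_derive_eq => //; rewrite ?addr_gt0// ?gt_eqF//.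
  by field; rewrite !gt_eqF ?addr_gt0.
have H1 := derive_at_positive_min _ _ _ dc c0 (fun t => J m t m0).
have H2 := derive_at_positive_min _ _ _ dm m0 (fun t pos => J t c pos c0).
split.
  rewrite xi_at1 ln_div ?posrE ?addr_gt0//; apply/eqP; rewrite -subr_eq0.
  exact/eqP.
rewrite -/nu; have -> : nu = (c * (c + m))^-1; last by rewrite invrK.
move/eqP: H1; rewrite addr_eq0 => /eqP ->.
by field; rewrite !gt_eqF ?addr_gt0.
Qed.

(** Sizes the perturbations below: [d] is the slack of a strict inequality and [D s] the loss caused
    by a perturbation of size [s]. *)
Lemma small_factor (d D : R) : 0 < d -> 0 <= D -> exists2 s, 0 < s < 1 & D * s < d.
Proof.
move=> d0 D0; have dD : 0 < d + D + 1 by lra.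
exists (d / (d + D + 1)).
  by rewrite divr_gt0//= ltr_pdivrMr// mul1r; lra.
by rewrite mulrA ltr_pdivrMr//; nra.
Qed.

Lemma xi2_le mu p x y : mu <= 1 -> 0 <= x -> x <= y -> xi2 mu p x <= xi2 mu p y.
Proof.
move=> mu1 x0 xy; rewrite xi2E lerD2l ler_wpM2l ?mulr_ge0 ?subr_ge0//.
by rewrite lerXn2r ?nnegrE// (le_trans x0).
Qed.

(* The competitor is the minimum of [phi] and the line of slope [- m / 2] that
   crosses it at a small [s]. *)
Lemma minimizer_at0 mu p m c : 0 <= mu -> mu <= 1 -> 0 < m -> 0 < c ->
  (forall psi : R -> R, in_C psi -> (P0 mu p (phi_lin m c) <= P0 mu p psi)%E) ->
  xi2 mu p 0 * (c + m) ^+ 2 <= 1.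
Proof.
move=> mu0 mu1 m0 c0 Hmin; rewrite leNgt; apply/negP => gt1.
set w := xi2 mu p 0 in gt1.
have w0 : 0 <= w by exact: xi2_ge0.
(* As [phi s = c + m - m s], going from 0 to [s] costs [w phi^2] at most [2 w m (c + m) s]. *)
have [||s /andP[s0 s1] Hs] :=
  small_factor (w * (c + m) ^+ 2 - 1) (2 * w * m * (c + m)).
- by rewrite subr_gt0.
- by rewrite !mulr_ge0// ltW// addr_gt0.
have ms0 : 0 < m / 2 by lra.
have c'0 : 0 < c + m / 2 * (1 - s) by rewrite addr_gt0// mulr_gt0// subr_gt0.
have E t : phi_lin (m / 2) (c + m / 2 * (1 - s)) t = phi_lin m c t - m / 2 * (s - t).
  by rewrite /phi_lin; field.
have /= := @minimizer_le R mu p m c (m / 2) (c + m / 2 * (1 - s)) (s / 2)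
  mu0 mu1 m0 c0 ms0 c'0 Hmin.
rewrite leNgt E ltrBlDr ltrDl mulr_gt0//; last lra.
move=> F; suff : false by []. apply: F; last by rewrite in_itv/=; lra.
move=> t /andP[t0 t1]; rewrite E ltrBlDr ltrDl pmulr_rgt0// subr_gt0 => ts.
have Fs : 0 < phi_lin m c s by apply: phi_lin_gt0 => //; exact: ltW.
have wt : w <= xi2 mu p t by exact: xi2_le.
clearbody w.
have Q : 1 < w * (phi_lin m c s * phi_lin m c s).
  have ms2 : 0 <= w * (m * s) ^+ 2 by rewrite mulr_ge0// sqr_ge0.
  rewrite [ltRHS](_ : _ = w * (c + m) ^+ 2 - 2 * w * m * (c + m) * s +
    w * (m * s) ^+ 2); last by rewrite /phi_lin; ring.
  by lra.
apply: (lt_le_trans Q); apply: (ler_pM w0 _ wt).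
  by rewrite mulr_ge0// ltW.
(* Left of the crossing point both lines are at least [phi s]. *)
have h1 : 0 <= m * (s - t) by rewrite mulr_ge0 ?subr_ge0 ?ltW.
have Es : phi_lin m c t = phi_lin m c s + m * (s - t) by rewrite /phi_lin; ring.
by apply: ler_pM; rewrite ?(ltW Fs)// Es; lra.
Qed.

(* The competitor is the minimum of [phi] and a slightly steeper line that
   crosses it at some [s] close to [1]. *)
Lemma minimizer_at1 mu p m c : 0 <= mu -> mu <= 1 -> 0 < m -> 0 < c ->
  (forall psi : R -> R, in_C psi -> (P0 mu p (phi_lin m c) <= P0 mu p psi)%E) ->
  xi2 mu p 1 * c ^+ 2 <= 1.
Proof.
move=> mu0 mu1 m0 c0 Hmin; rewrite leNgt; apply/negP => gt1.
have [s /andP[s0 s1] Hs] : exists2 s, 0 < s < 1 & 1 < xi2 mu p s * c ^+ 2.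
  near (1 : R)^'- => s; exists s.
    by apply/andP; split; near: s; [exact: nbhs_left_gt|exact: nbhs_left_lt].
  near: s.
  have cW : xi2 mu p t * c ^+ 2 @[t --> (1 : R)^'-] --> xi2 mu p 1 * c ^+ 2.
    apply: cvg_at_left_filter; apply: cvgMl; exact: continuous_xi2.
  exact: (cvgr_gt _ cW).
have w0 : 0 <= xi2 mu p s by apply: xi2_ge0 => //; exact: ltW.
set w := xi2 mu p s in Hs w0.
have [||e /andP[e0 e1] He] := small_factor (w * c ^+ 2 - 1) (w * c * (1 - s)).
- by rewrite subr_gt0.
- by apply: mulr_ge0; [apply: mulr_ge0 => //; exact: ltW|lra].
have me0 : 0 < m + e by rewrite addr_gt0.
(* The choice of [e] says [w c (c - e (1 - s)) > 1], which forces the last factor to be positive. *)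
have c'0 : 0 < c - e * (1 - s) by nra.
have E t : phi_lin (m + e) (c - e * (1 - s)) t = phi_lin m c t - e * (t - s).
  by rewrite /phi_lin; ring.
have /= := @minimizer_le R mu p m c (m + e) (c - e * (1 - s)) ((1 + s) / 2)
  mu0 mu1 m0 c0 me0 c'0 Hmin.
rewrite leNgt E ltrBlDr ltrDl mulr_gt0//; last lra.
move=> F; suff : false by []. apply: F; last by rewrite in_itv/=; lra.
move=> t /andP[t0 t1]; rewrite E ltrBlDr ltrDl pmulr_rgt0// subr_gt0 => st.
have wt : w <= xi2 mu p t by apply: xi2_le => //; exact: ltW.
clearbody w.
have Q : 1 < w * (c * (c - e * (1 - s))).
  rewrite [ltRHS](_ : _ = w * c ^+ 2 - w * c * (1 - s) * e); last by ring.
  by rewrite ltrBrDr -ltrBrDl.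
apply: (lt_le_trans Q); apply: (ler_pM w0 _ wt).
  by rewrite mulr_ge0// ltW.
have h1 m'' c'' : 0 < m'' -> c'' <= phi_lin m'' c'' t.
  by move=> m''0; rewrite /phi_lin lerDr (mulr_ge0 (ltW m''0))// subr_ge0.
by apply: ler_pM; [exact: ltW|exact: ltW|exact: h1|rewrite -E; exact: h1].
Unshelve. all: by end_near. Qed.

End optimality.

Local Close Scope classical_set_scope.

Theorem theorem1p25 (R : realType) (p : nat) (mu : R) :
  (3 <= p)%N -> 0 <= mu -> mu < 1 ->
  ((exists m c : R, 0 < m /\ 0 < c /\ in_C (phi_lin m c) /\
      forall psi : R -> R, in_C psi ->
        (P0 mu p (phi_lin m c) <= P0 mu p psi)%E)
   <->
   ((forall m c : R, 0 < m -> 0 < c -> mc_system mu p m c ->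
       0 <= replicon mu p m c) /\
    pure_like_or_critical mu p)).
Proof.
move=> p3 mu0 mu1; have mu1' := ltW mu1; have p1 : (1 < p)%N by exact: ltnW.
have nu2 := xi1_at1_gt2 mu p mu1 p3.
have nu0 : 0 < xi1 mu p 1 by lra.
(* So [nu''/nu' > 1], the range in which [aba_ge0] reads off the sign of [aba]. *)
have nu_lt : xi1 mu p 1 < xi2 mu p 1.
  rewrite xi1E xi2E !expr1n !mulr1 ltrD2l ltr_pMr ?ltr1n.
    by case: (p) p3 => [|[|[]]].
  by rewrite mulr_gt0 ?subr_gt0// ltr0n ltnW.
split=> [[m [c [m0 [c0 [_ Hmin]]]]]|[Hrep _]].
  have sys := minimizer_mc_system mu p m c p1 m0 c0 Hmin.
  split=> [m' c' m'0 c'0 sys'|].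
    have [<- <-] := mc_system_unique mu p m c m' c' nu2 m0 c0 m'0 c'0 sys sys'.
    rewrite repliconE// subr_ge0 -[leRHS]mul1r ler_pdivlMr ?exprn_gt0 ?addr_gt0//.
    exact: minimizer_at0.
  have [r0 cr] := (mc_systemP mu p m c m0 c0 nu0).1 sys.
  suff : 0 <= ABA mu p by rewrite le_eqVlt => /predU1P[e|]; [right|left].
  rewrite ABAE ?(lt_trans nu0)// (aba_ge0 _ _ _ nu2 _ r0).
  (* Writing 1 as [c^2 xi'(1) r] and cancelling [c^2] turns [xi''(1) c^2 <= 1] into
     [xi''(1) <= r xi'(1)]. *)
  - rewrite ler_pdivrMr//; have := minimizer_at1 mu p m c mu0 mu1' m0 c0 Hmin.
    rewrite -[X in _ <= X -> _]cr [X in X <= _ -> _]mulrC.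
    by rewrite ler_pM2l ?exprn_gt0// mulrC.
  - by rewrite ltr_pdivlMr// mul1r ltrDl.
  - by rewrite ltr_pdivlMr// mul1r.
have [m [c [m0 c0 sys]]] := mc_system_exists mu p nu2.
have Q0 : xiphi mu p m c 0 <= 1.
  have := Hrep m c m0 c0 sys; rewrite repliconE// subr_ge0 -[leRHS]mul1r.
  by rewrite ler_pdivlMr ?exprn_gt0 ?addr_gt0// /xiphi /phi_lin subr0 mulr1 addrC.
exists m, c; do 3 split=> //; first exact: in_C_phi_lin.
move=> psi Cpsi.
have [||a [b ab]] := chord_exists (fun t => xiphi mu p m c t - 1) psi Cpsi.
- move=> x y z x0 xy yz z1; rewrite !subr_gt0.
  exact: xiphi_interval.
- move=> x x01; rewrite subr_gt0 => /(xiphi_two _ _ _ _ _ Q0 x01)[y y01 [yx Qy]].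
  by exists y => //; rewrite subr_gt0.
apply: (P0_min_of_affine mu p m c a b) => // t t01.
have phi0 : 0 < phi_lin m c t by rewrite phi_lin_gt0//; case/andP: t01.
rewrite [leRHS](_ : _ = (xiphi mu p m c t - 1) * (psi t - (a + b * t)) /
  phi_lin m c t ^+ 2); last by rewrite /xiphi; field; rewrite gt_eqF.
by rewrite divr_ge0 ?ab// exprn_ge0// ltW.
Qed.
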